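(* Let $G=G[X,Y]$ be a finite bipartite graph (multiple edges allowed) with bipartition $\{X,Y\}$, and let $f,g$ be integer-valued functions on $X\cup Y$ such that $0\le g(v)\le f(v)$ for every $v\in X\cup Y$ and $g(y)=0$ for every $y\in Y$. Then $G$ has a $(g,f)$-factor if and only if $$\sum_{b\in B} f(b)\;\ge\;\sum_{x\in A}\max\bigl\{0,\; g(x)-e_G(x,\,Y\setminus B)\bigr\}\qquad\text{for all } A\subseteq X,\ B\subseteq Y.$$
   Context: Graphs are finite and may have multiple (parallel) edges. For a graph $G$, a vertex $u$ and a set $S$ of vertices, $\deg_G(u)$ is the number of edges of $G$ incident with $u$, and $e_G(u,S)$ is the number of edges of $G$ between $u$ and $S$, both counted with multiplicity. A $(g,f)$-factor of $G$ is a spanning subgraph $F$ of $G$ (same vertex set, edge set a subset of the edges of $G$, parallel edges being regarded as distinct) such that $g(v)\le \deg_F(v)\le f(v)$ for every vertex $v$. *)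

(* Defs.v *)
From HB Require Import structures.
From mathcomp Require Import all_boot all_order all_algebra.

Set Implicit Arguments.
Unset Strict Implicit.
Unset Printing Implicit Defensive.

Import Order.TTheory GRing.Theory Num.Theory.

(* Finite loopless multigraphs: parallel edges are distinct elements of
   [edge G] with the same pair of ends. *)
Record mgraph (V : finType) := MGraph {
  edge : finType;
  ends : edge -> {set V};
  card_ends : forall e : edge, #|ends e| = 2
}.

Arguments ends {V} G e : rename.
Arguments card_ends {V} G e : rename.

Section Multigraph.
Variables (V : finType) (G : mgraph V).

Definition deg (u : V) : nat := #|[set e : edge G | u \in ends G e]|.

Definition edges_between (u : V) (S : {set V}) : nat :=
  #|[set e : edge G | [exists w in S, ends G e == [set u; w]]]|.

Definition spanning_subgraph (F : {set edge G}) : mgraph V :=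
  @MGraph V {e : edge G | e \in F}
    (fun e => ends G (val e)) (fun e => card_ends G (val e)).

(* X and Y are allowed to be empty. *)
Definition bipartition (X Y : {set V}) : Prop :=
  [/\ X :|: Y = [set: V], [disjoint X & Y]
    & forall e : edge G,
        exists x y, [/\ x \in X, y \in Y & ends G e = [set x; y]]].

End Multigraph.

Local Open Scope ring_scope.

Definition is_factor (V : finType) (G : mgraph V) (g f : V -> int)
    (F : {set edge G}) : Prop :=
  forall v : V, g v <= (deg (spanning_subgraph F) v)%:Z <= f v.

Definition has_factor (V : finType) (G : mgraph V) (g f : V -> int) : Prop :=
  exists F : {set edge G}, is_factor g f F.

(* Main.v *)
Require Import Defs.
From HB Require Import structures.
From mathcomp Require Import all_boot all_order all_algebra.
From mathcomp Require Import zify.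

(** Necessity is a double count.  If [F] is a factor, then an [x] in [A] has at
    most [e_G(x, Y \ B)] edges of [F] leading outside [B], so at least
    [max 0 (g x - e_G(x, Y \ B))] of them end in [B]; summed over [A], these
    edges number at most the sum over [B] of the degrees in [F], hence at most
    the sum of [f] over [B].

    For sufficiency, [max 0 z >= z], so the condition gives every pair [(A, B)]
    nonnegative slack [f(B) + e(A, Y \ B) - g(A)].  Since [g]
    vanishes on [Y], it is enough to find edges giving each [x] exactly [g x]
    and each [y] at most [f y] of them ([exists_exact_left_degrees]).  This goes
    by induction on the number of edges.  An edge [xy] can be discarded, or
    selected at the cost of lowering [g x] and [f y] by one; the claim is that
    one of the two preserves nonnegative slack.  Discarding fails only if some
    pair [(A1, B1)] with [x] in [A1] and [y] not in [B1] has slack zero;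
    selecting fails only if some [(A2, B2)] with [x] not in [A2] and [y] in
    [B2] has slack zero.  The slack is submodular ([cut_submodular]), and the
    edge [xy] is counted by [(A1, B1)] but by neither the union nor the
    intersection of the two pairs, so one of these would have negative slack. *)

Set Implicit Arguments.
Unset Strict Implicit.
Unset Printing Implicit Defensive.

Import Order.TTheory GRing.Theory Num.Theory.

Lemma card_set_sum (E : finType) (F : {set E}) (P : pred E) :
  #|[set e in F | P e]| = \sum_(e in F) P e.
Proof.
rewrite -sum1_card big_mkcond [RHS]big_mkcond /=.
by apply: eq_bigr => e _; rewrite inE; case: (e \in F); case: (P e).
Qed.

Lemma sum_setUI (T : finType) (w : T -> nat) (A B : {set T}) :
  \sum_(x in A :|: B) w x + \sum_(x in A :&: B) w x
  = \sum_(x in A) w x + \sum_(x in B) w x.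
Proof.
rewrite [X in X + _ = _]big_mkcond [X in _ + X = _]big_mkcond /=.
rewrite [X in _ = X + _]big_mkcond [X in _ = _ + X]big_mkcond /=.
rewrite -!big_split /=; apply: eq_bigr => x _.
by rewrite !inE; case: (x \in A); case: (x \in B); rewrite ?addn0.
Qed.

Lemma sum_decr (T : finType) (w : T -> nat) (a : T) (A : {set T}) :
  0 < w a ->
  \sum_(x in A) w x = \sum_(x in A) (w x - (x == a)) + (a \in A).
Proof.
move=> wa; have [aA|aA] := boolP (a \in A).
  rewrite (big_setD1 a) //= [in RHS](big_setD1 a) //= eqxx.
  rewrite [in RHS](eq_bigr w) /=; first by lia.
  by move=> x; rewrite !inE => /andP[/negPf-> _]; rewrite subn0.
rewrite addn0; apply: eq_bigr => x xA.
by case: eqP xA aA => [-> ->//|_ _ _]; rewrite subn0.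
Qed.

(** * Degree-constrained edge sets in bipartite multigraphs *)

Section DegreeConstrained.
Variables (E S T : finType) (s : E -> S) (t : E -> T).
Implicit Types (D F : {set E}) (A : {set S}) (B : {set T}).

Definition cut D A B : nat := \sum_(e in D) ((s e \in A) && (t e \notin B)).

Definition nonneg_slack D (g : S -> nat) (f : T -> nat) :=
  [forall A : {set S}, forall B : {set T},
    \sum_(x in A) g x <= \sum_(y in B) f y + cut D A B].

Lemma nonneg_slackP D g f :
  reflect (forall A B, \sum_(x in A) g x <= \sum_(y in B) f y + cut D A B)
          (nonneg_slack D g f).
Proof. by apply: (iffP 'forall_forallP). Qed.

(** Each single edge contributes a submodular function of the pair. *)
Lemma cut_submodular D A1 A2 B1 B2 :
  cut D (A1 :|: A2) (B1 :|: B2) + cut D (A1 :&: A2) (B1 :&: B2)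
  <= cut D A1 B1 + cut D A2 B2.
Proof.
rewrite /cut -!big_split /=; apply: leq_sum => e _; rewrite !inE.
by case: (s e \in A1); case: (s e \in A2); case: (t e \in B1);
   case: (t e \in B2).
Qed.

Lemma cut_setD1 D e A B :
  e \in D ->
  cut D A B = ((s e \in A) && (t e \notin B)) + cut (D :\ e) A B.
Proof. by move=> eD; rewrite /cut (big_setD1 e). Qed.

(** The uncrossing argument: if [e] cannot be discarded, it can be selected.
    The bounds [0 < g (s e)] and [0 < f (t e)] make the truncated differences
    genuine; they follow from the tight pair that obstructs the discarding of
    [e], by removing [s e] from its first set or adding [t e] to its second. *)
Lemma select_edge D g f e :
  e \in D -> nonneg_slack D g f -> ~~ nonneg_slack (D :\ e) g f ->
  [/\ 0 < g (s e), 0 < f (t e) &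
      nonneg_slack (D :\ e) (fun x => g x - (x == s e))
                            (fun y => f y - (y == t e))].
Proof.
move=> eD /nonneg_slackP slackD /forallPn[A1 /forallPn[B1]].
rewrite -ltnNge => viol1.
have [sA1 tB1] : s e \in A1 /\ t e \notin B1.
  move: (slackD A1 B1); rewrite (cut_setD1 _ _ eD).
  by case: (s e \in A1) (t e \in B1) => [] [] //=; lia.
have g_gt0 : 0 < g (s e).
  have := slackD (A1 :\ s e) B1; rewrite (cut_setD1 _ _ eD) !inE eqxx /=.
  move: viol1; rewrite (big_setD1 (s e)) //=.
  suff : cut (D :\ e) (A1 :\ s e) B1 <= cut (D :\ e) A1 B1 by lia.
  apply: leq_sum => e' _; rewrite !inE.
  by case: (s e' == s e); case: (s e' \in A1); case: (t e' \in B1).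
have f_gt0 : 0 < f (t e).
  have := slackD A1 (t e |: B1); rewrite (cut_setD1 _ _ eD) !inE eqxx andbF /=.
  rewrite big_setU1 //=.
  suff : cut (D :\ e) A1 (t e |: B1) <= cut (D :\ e) A1 B1 by lia.
  apply: leq_sum => e' _; rewrite !inE.
  by case: (t e' == t e); case: (s e' \in A1); case: (t e' \in B1).
split=> //; apply/nonneg_slackP => A2 B2.
have := slackD A2 B2; have := slackD (A1 :|: A2) (B1 :|: B2).
have := slackD (A1 :&: A2) (B1 :&: B2).
have := cut_submodular (D :\ e) A1 A2 B1 B2.
have := sum_setUI g A1 A2; have := sum_setUI f B1 B2.
rewrite !(cut_setD1 _ _ eD) !inE sA1 (negPf tB1) /=.
rewrite (sum_decr A2 g_gt0) (sum_decr B2 f_gt0).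
by case: (s e \in A2); case: (t e \in B2) => /=; lia.
Qed.

Lemma exists_exact_left_degrees D g f :
  nonneg_slack D g f ->
  exists F, [/\ F \subset D,
    forall x, \sum_(e in F) (s e == x) = g x &
    forall y, \sum_(e in F) (t e == y) <= f y].
Proof.
have [n] := ubnP #|D|; elim: n D g f => // n IHn D g f cardD slackD.
have [D0|[e eD]] := set_0Vmem D.
  exists set0; split=> [|x|y]; rewrite ?sub0set ?big_set0 //.
  move/nonneg_slackP/(_ [set x] set0): slackD.
  by rewrite D0 /cut !big_set0 big_set1; lia.
have cardDe : #|D :\ e| < n by rewrite (cardsD1 e D) eD in cardD.
have [discard|select] := boolP (nonneg_slack (D :\ e) g f).
  have [F [FD Fg Ff]] := IHn _ _ _ cardDe discard.
  by exists F; split=> //; apply: subset_trans FD (subsetDl _ _).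
have [g_gt0 f_gt0 slackDe] := select_edge eD slackD select.
have [F [FD Fg Ff]] := IHn _ _ _ cardDe slackDe.
have eF : e \notin F by apply/negP => /(subsetP FD); rewrite !inE eqxx.
exists (e |: F); split=> [|x|y].
- rewrite subUset sub1set eD.
  exact: subset_trans FD (subsetDl _ _).
- rewrite big_setU1 //= Fg eq_sym; case: eqP => [->|_] /=; lia.
- rewrite big_setU1 //=; move: (Ff y); rewrite (eq_sym y).
  by case: eqP => [<-|_] /=; lia.
Qed.

End DegreeConstrained.

(** * Oriented bipartite multigraphs *)

Section Oriented.
Variables (V : finType) (G : mgraph V) (X Y : {set V}).
Variables (s t : edge G -> V).
Hypothesis disjXY : [disjoint X & Y].
Hypothesis sX : forall e, s e \in X.
Hypothesis tY : forall e, t e \in Y.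
Hypothesis ends_st : forall e, ends G e = [set s e; t e].

Lemma deg_spanning_subgraph (F : {set edge G}) (v : V) :
  deg (spanning_subgraph F) v = \sum_(e in F) (v \in ends G e).
Proof.
rewrite -card_set_sum /deg -(card_imset _ val_inj); apply: eq_card => e.
apply/imsetP/idP => [[e' + ->]|]; rewrite !inE; first by rewrite (valP e').
by move=> /andP[eF ve]; exists (Sub e eF); rewrite ?inE.
Qed.

Lemma neq_XY (x y : V) : x \in X -> y \in Y -> (x == y) = false.
Proof.
move=> xX yY; apply/eqP => xy; move: yY.
by rewrite -xy (disjointFr disjXY xX).
Qed.

Lemma degX F x : x \in X ->
  deg (spanning_subgraph F) x = \sum_(e in F) (s e == x).
Proof.
move=> xX; rewrite deg_spanning_subgraph; apply: eq_bigr => e _.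
by rewrite ends_st !inE (neq_XY xX (tY e)) orbF eq_sym.
Qed.

Lemma degY F y : y \in Y ->
  deg (spanning_subgraph F) y = \sum_(e in F) (t e == y).
Proof.
move=> yY; rewrite deg_spanning_subgraph; apply: eq_bigr => e _.
by rewrite ends_st !inE eq_sym (neq_XY (sX e) yY) eq_sym.
Qed.

Lemma edges_betweenXY (x : V) (B : {set V}) : x \in X ->
  edges_between G x (Y :\: B) =
  \sum_(e : edge G) ((s e == x) && (t e \notin B)).
Proof.
move=> xX; rewrite /edges_between -sum1_card big_mkcond /=.
apply: eq_bigr => e _; rewrite inE.
suff -> : [exists w in Y :\: B, ends G e == [set x; w]]
          = (s e == x) && (t e \notin B) by case: (_ && _).
apply/exists_inP/andP => [[w]|[/eqP sx tB]]; last first.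
  by exists (t e); rewrite ?inE ?tB ?tY // ends_st sx.
rewrite inE => /andP[wB wY] /eqP ends_xw.
have : s e \in [set x; w] by rewrite -ends_xw ends_st set21.
have : t e \in [set x; w] by rewrite -ends_xw ends_st set22.
rewrite !inE (neq_XY (sX e) wY) orbF eq_sym (neq_XY xX (tY e)) /=.
by move=> /eqP->.
Qed.

Lemma sum_edges_between (A B : {set V}) : A \subset X ->
  \sum_(x in A) edges_between G x (Y :\: B) = cut s t setT A B.
Proof.
move=> AX; rewrite (eq_bigr _ (fun x xA => edges_betweenXY B (subsetP AX x xA))).
rewrite /cut exchange_big /=.
rewrite [RHS]big_mkcond; apply: eq_bigr => e _; rewrite inE.
have [sA|sA] := boolP (s e \in A).
  rewrite (bigD1 (s e)) //= eqxx big1 ?addn0 // => x /andP[_].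
  by rewrite eq_sym => /negPf->.
by rewrite big1 // => x xA; case: eqP sA xA => [->/negPf->|].
Qed.

(** Both sides are compared with the number of edges of [F] joining [A] to [B]:
    at most [edges_between G x (Y :\: B)] edges of [F] at [x] avoid [B], and
    each edge into [B] is counted in the degree of its end there. *)
Lemma factor_double_count (F : {set edge G}) (A B : {set V}) :
  A \subset X -> B \subset Y ->
  \sum_(x in A) (deg (spanning_subgraph F) x - edges_between G x (Y :\: B))
  <= \sum_(y in B) deg (spanning_subgraph F) y.
Proof.
move=> AX BY.
apply: (@leq_trans (\sum_(x in A) \sum_(e in F) ((s e == x) && (t e \in B)))).
  apply: leq_sum => x xA; have xX := subsetP AX x xA.
  rewrite degX // edges_betweenXY // leq_subLR.
  have inF : \sum_(e in F) ((s e == x) && (t e \notin B))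
      <= \sum_(e : edge G) ((s e == x) && (t e \notin B)).
    by rewrite big_mkcond /=; apply: leq_sum => e _; case: ifP.
  apply: leq_trans (leq_add inF (leqnn _)).
  rewrite -big_split /=; apply: leq_sum => e _.
  by case: (s e == x); case: (t e \in B).
rewrite (eq_bigr _ (fun y yB => degY F (subsetP BY y yB))).
rewrite exchange_big [leqRHS]exchange_big /=; apply: leq_sum => e _.
have [tB|tB] := boolP (t e \in B); last by rewrite big1 // => x _; rewrite andbF.
rewrite [leqRHS](bigD1 (t e)) //= eqxx.
suff : \sum_(x in A) ((s e == x) && true) <= 1 by lia.
have [sA|sA] := boolP (s e \in A).
  rewrite (bigD1 (s e)) //= big1 ?addn0 ?leq_b1 // => x /andP[_].
  by rewrite eq_sym => /negPf->.
by rewrite big1 // => x xA; case: eqP sA xA => [->/negPf->|].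
Qed.

End Oriented.

Local Open Scope ring_scope.

Theorem theorem1p3 (V : finType) (G : mgraph V) (X Y : {set V})
    (f g : V -> int)
    (hXY : bipartition G X Y)
    (hgf : forall v : V, 0 <= g v <= f v)
    (hgY : forall y : V, y \in Y -> g y = 0) :
  has_factor G g f <->
  (forall A B : {set V}, A \subset X -> B \subset Y ->
     \sum_(b in B) f b >=
     \sum_(x in A) Num.max 0 (g x - (edges_between G x (Y :\: B))%:Z)).
Proof.
have [XY_T disjXY /fin_all_exists[s /fin_all_exists[t st]]] := hXY.
have sX e : s e \in X by have [] := st e.
have tY e : t e \in Y by have [] := st e.
have ends_st e : ends G e = [set s e; t e] by have [] := st e.
split=> [[F factF] A B AX BY|slack].
  have := factor_double_count disjXY sX tY ends_st F AX BY.
  rewrite -lez_nat !(big_morph Posz PoszD (erefl _)) => count.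
  apply: le_trans (le_trans count _); apply: ler_sum => v _.
    by have /andP[] := factF v; lia.
  by have /andP[] := factF v.
have fE v : f v = `|f v|%N by have := hgf v; lia.
have gE v : g v = `|g v|%N by have := hgf v; lia.
have slackG : nonneg_slack s t setT (fun v => `|g v|%N) (fun v => `|f v|%N).
  apply/nonneg_slackP => A B.
  (* The hypothesis only covers subsets of [X] and of [Y]; intersecting with
     them keeps the sum of [g], which is zero off [X], and the cut, and can only
     lower the sum of [f]. *)
  have [AX BY] := (subsetIr A X, subsetIr B Y).
  have gAX : (\sum_(x in A) `|g x| = \sum_(x in A :&: X) `|g x|)%N.
    rewrite big_mkcond [RHS]big_mkcond; apply: eq_bigr => v _; rewrite inE.
    have := in_setT v; rewrite -XY_T inE.
    by case: (v \in X) => /= [_|/hgY->]; case: (v \in A).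
  have fBY : (\sum_(y in B :&: Y) `|f y| <= \sum_(y in B) `|f y|)%N.
    rewrite big_mkcond [leqRHS]big_mkcond; apply: leq_sum => v _; rewrite inE.
    by case: (v \in B) (v \in Y) => [] [].
  have cutXY : cut s t setT (A :&: X) (B :&: Y) = cut s t setT A B.
    by apply: eq_bigr => e _; rewrite !inE sX tY !andbT.
  rewrite gAX -cutXY -(sum_edges_between disjXY sX tY ends_st) //.
  apply: leq_trans (leq_add fBY (leqnn _)).
  rewrite -lez_nat PoszD !(big_morph Posz PoszD (erefl _)) -lerBlDr.
  rewrite -sumrB (eq_bigr f) => [|v _]; last by rewrite -fE.
  apply: le_trans (slack _ _ AX BY); apply: ler_sum => v _.
  by rewrite -gE; lia.
have [F [_ Fg Ff]] := exists_exact_left_degrees slackG.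
exists F => v; have := in_setT v; rewrite -XY_T inE => /orP[vX|vY].
  rewrite (degX disjXY tY ends_st) // Fg; have := hgf v; lia.
rewrite (degY disjXY sX ends_st) //; have := Ff v; rewrite hgY //.
have := hgf v; lia.
Qed.
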